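(* Let $X,Y$ be $c$-free with respect to $(\varphi,\psi)$ on $\mathbb{C}\langle X,Y\rangle$. Define a linear map $\overrightarrow{E}^\varphi_X:\mathbb{C}\langle X,Y\rangle\to\mathbb{C}\langle X\rangle$ recursively on monomials (by induction on block length) by: (i) $\overrightarrow{E}^\varphi_X[P(X)]=P(X)$ for $P\in\mathbb{C}\langle X\rangle$; (ii) $\overrightarrow{E}^\varphi_X[P(Y)]=\varphi(P(Y))$ for $P\in\mathbb{C}\langle Y\rangle$; (iii) if the monomial $W$ starts with $Y$: $\overrightarrow{E}^\varphi_X[W]=\beta^{b,\varphi}_Y(W)+(\beta^{b,\varphi}_Y\otimes\overrightarrow{E}^\varphi_X)[\overrightarrow{\delta}_XW]$; (iv) if $W$ starts with $X$: $\overrightarrow{E}^\varphi_X[W]=E^\psi_X[W]+\bigl(\beta^{b,\varphi}_X\otimes(\overrightarrow{E}^\varphi_X-E^\psi_X)\bigr)[\overrightarrow{\delta}_YW]$. Then $\overrightarrow{E}^\varphi_X$ is well defined and is a right quasi-conditional expectation for $\varphi$ onto $\mathbb{C}\langle X\rangle$, i.e. $\varphi(\overrightarrow{E}^\varphi_X[P])=\varphi(P)$ for all $P\in\mathbb{C}\langle X,Y\rangle$ and $\overrightarrow{E}^\varphi_X[PQ(X)]=\overrightarrow{E}^\varphi_X[P]Q(X)$ for all $P\in\mathbb{C}\langle X,Y\rangle$, $Q\in\mathbb{C}\langle X\rangle$. Moreover, for every monomial $W$, $$\overrightarrow{E}^\varphi_X[W]=\beta^{b,\varphi}_Y(W)+(\mathring\beta^{b,\varphi}_Y\otimes\overrightarrow{E}^\varphi_X)[\overrightarrow{\delta}_XW]+\bigl(\mathring\beta^{b,\varphi}_X\otimes(\overrightarrow{E}^\varphi_X-E^\psi_X)\bigr)[\overrightarrow{\delta}_YW]+X\,E^\psi_X[L_X(W)],$$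 where $\mathring\beta^{b,\varphi}_{\bullet}=\beta^{b,\varphi}_{\bullet}-\epsilon$ and $L_X(W)=W'$ if $W=XW'$, $L_X(W)=0$ otherwise.
   Context: $\epsilon(P)$ is the constant coefficient of $P$. $X,Y$ are $c$-free w.r.t. $(\varphi,\psi)$ (unital functionals on $\mathbb{C}\langle X,Y\rangle$) if $\psi(u_1\cdots u_n)=0$ and $\varphi(u_1\cdots u_n)=\prod\varphi(u_j)$ whenever the $u_j$ alternate between $\mathbb{C}\langle X\rangle$ and $\mathbb{C}\langle Y\rangle$ and $\psi(u_j)=0$. Boolean cumulants $\beta^\theta_n$: $\theta(a_1\cdots a_n)=\sum_k\beta^\theta_k(a_1,\dots,a_k)\theta(a_{k+1}\cdots a_n)$. Block factorization of a monomial $W\ne1$: $W=U_1\cdots U_n$, nonempty pure-$X$/pure-$Y$ monomials alternating (block length $n$). $\beta^{b,\theta}_X(1)=1$, $\beta^{b,\theta}_X(W)=\beta^\theta_n(U_1,\dots,U_n)$ if $W$ starts and ends with the letter $X$, else $0$; $\beta^{b,\theta}_Y$ analogously. $\overrightarrow{\delta}_X(W)=\sum_{W=UXV}U\otimes XV$ over all factorizations with monomials $U,V$ (similarly $\overrightarrow{\delta}_Y$), extended linearly; $(f\otimes g)(U\otimes V)=f(U)g(V)$. $E^\psi_X:\mathbb{C}\langle X,Y\rangle\to\mathbb{C}\langle X\rangle$ is linear with, for $W=X_0Y_1X_1\cdots Y_nX_n$ in block form ($X_0,X_n$ possibly $1$), $E^\psi_X[X_0]=X_0$ and for $n\ge1$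 $E^\psi_X[W]=\sum_{p=0}^{n-1}\sum_{0=i_0<i_1<\dots<i_p<i_{p+1}=n}X_0X_{i_1}\cdots X_{i_p}X_n\prod_{j=0}^p\beta^\psi_{2(i_{j+1}-i_j)-1}(Y_{i_j+1},X_{i_j+1},\dots,Y_{i_{j+1}})$. *)

(* Defs.v *)
From HB Require Import structures.
From mathcomp Require Import all_boot all_algebra complex Rstruct.
Set Implicit Arguments. Unset Strict Implicit. Unset Printing Implicit Defensive.
Import GRing.Theory.
Local Open Scope ring_scope.

Notation C := (complex Rdefinitions.R).

Definition word := seq bool.
Notation lX := true.
Notation lY := false.

Definition ncpoly := seq (C * word).
Definition ncmul (P Q : ncpoly) : ncpoly :=
  [seq (a.1 * b.1, a.2 ++ b.2) | a <- P, b <- Q].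
Definition app (f : word -> C) (P : ncpoly) : C := \sum_(cw <- P) cw.1 * f cw.2.
Definition linext (E : word -> {poly C}) (P : ncpoly) : {poly C} :=
  \sum_(cw <- P) cw.1 *: E cw.2.

(* C<X> (resp. C<Y>) is identified with {poly C}; [emb l p] is p(X) (l = lX)
   or p(Y) (l = lY) viewed inside C<X,Y>. *)
Definition emb (l : bool) (p : {poly C}) : ncpoly :=
  [seq (p`_k, nseq k l) | k <- iota 0 (size p)].
Definition appX (f : word -> C) (p : {poly C}) : C := app f (emb lX p).

Definition prodnc (us : seq (bool * {poly C})) : ncpoly :=
  foldr (fun u P => ncmul (emb u.1 u.2) P) [:: (1, [::])] us.

Definition c_free (phi psi : word -> C) : Prop :=
  forall us : seq (bool * {poly C}),
    (0 < size us)%N ->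
    sorted (fun u v : bool * {poly C} => u.1 != v.1) us ->
    (forall u, u \in us -> app psi (emb u.1 u.2) = 0) ->
    app psi (prodnc us) = 0 /\
    app phi (prodnc us) = \prod_(u <- us) app phi (emb u.1 u.2).

(* Boolean cumulants beta^theta_n(a_1,...,a_n) for monomial arguments,
   defined by theta(a_1...a_n) = sum_k beta_k(a_1..a_k) theta(a_{k+1}...a_n). *)
Fixpoint bcum_aux (theta : word -> C) (fuel : nat) (s : seq word) : C :=
  match fuel with
  | 0 => 0
  | fuel'.+1 =>
      theta (flatten s) -
      \sum_(1 <= k < size s) bcum_aux theta fuel' (take k s) * theta (flatten (drop k s))
  end.
Definition bcum (theta : word -> C) (s : seq word) : C := bcum_aux theta (size s) s.

Fixpoint blocks (w : word) : seq word :=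
  match w with
  | [::] => [::]
  | a :: w' =>
      match blocks w' with
      | (b :: bs) :: bss => if b == a then (a :: b :: bs) :: bss else [:: a] :: (b :: bs) :: bss
      | bss => [:: a] :: bss
      end
  end.

Definition bb (theta : word -> C) (l : bool) (W : word) : C :=
  if W is a :: _ then
    if (a == l) && (last a W == l) then bcum theta (blocks W) else 0
  else 1.

Definition eps (W : word) : C := (W == [::])%:R.
Definition bbo (theta : word -> C) (l : bool) (W : word) : C := bb theta l W - eps W.

(* (f (x) g)[delta_l W] = sum_{W = U l V} f(U) g(l V). *)
Definition dtens (l : bool) (f : word -> C) (g : word -> {poly C}) (W : word) : {poly C} :=
  \sum_(i < size W | nth l W i == l) f (take i W) *: g (drop i W).

(* Decomposition W = X_0 Y_1 X_1 ... Y_n X_n : pairs (Y_i, X_i), X_n possibly empty. *)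
Fixpoint pairup (bs : seq word) : seq (word * word) :=
  match bs with
  | y :: x :: rest => (y, x) :: pairup rest
  | [:: y] => [:: (y, [::])]
  | [::] => [::]
  end.
Definition X0 (W : word) : word := if W is lX :: _ then head [::] (blocks W) else [::].
Definition YXpairs (W : word) : seq (word * word) :=
  if W is lX :: _ then pairup (behead (blocks W)) else pairup (blocks W).

(* (Y_{a+1}, X_{a+1}, ..., X_{b-1}, Y_b) *)
Definition seg (ys : seq (word * word)) (a b : nat) : seq word :=
  take (2 * (b - a) - 1) (flatten [seq [:: p.1; p.2] | p <- take (b - a) (drop a ys)]).

(* E^psi_X : C<X,Y> -> C<X> on monomials.  The cut points
   0 = i_0 < i_1 < ... < i_p < i_{p+1} = n are encoded by a bitmask t selecting
   {i_1,...,i_p} inside {1,...,n-1}. *)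
Definition EpsiX (psi : word -> C) (W : word) : {poly C} :=
  let ys := YXpairs W in
  let n := size ys in
  if n is 0 then 'X^(size (X0 W)) else
  \sum_(t : (n.-1).-tuple bool)
    let c := 0%N :: rcons (mask t (iota 1 n.-1)) n in
    'X^(size (X0 W) + \sum_(i <- mask t (iota 1 n.-1)) size (nth ([::], [::]) ys i.-1).2
         + size (nth ([::], [::]) ys n.-1).2)
    * (\prod_(ab <- zip c (behead c)) bcum psi (seg ys ab.1 ab.2))%:P.

Definition XEpsiLX (psi : word -> C) (W : word) : {poly C} :=
  if W is lX :: W' then 'X * EpsiX psi W' else 0.

Definition Erec_spec (phi psi : word -> C) (E : word -> {poly C}) : Prop :=
  [/\ (forall p : {poly C}, linext E (emb lX p) = p),
      (forall p : {poly C}, linext E (emb lY p) = (app phi (emb lY p))%:P),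
      (forall W', E (lY :: W') =
                  (bb phi lY (lY :: W'))%:P + dtens lX (bb phi lY) E (lY :: W'))
    & (forall W', E (lX :: W') =
                  EpsiX psi (lX :: W') +
                  dtens lY (bb phi lX) (fun V => E V - EpsiX psi V) (lX :: W'))].

(* Main.v *)
From HB Require Import structures.
Require Import Defs.
From mathcomp Require Import all_boot all_algebra complex Rstruct ring.
Set Implicit Arguments.
Unset Strict Implicit.
Unset Printing Implicit Defensive.
Import GRing.Theory.
Local Open Scope ring_scope.

(** Let Delta(L) = g(L) - sum_{k >= 1} beta(L_1, ..., L_k) g(L_{k+1} ...) be the
    defect of a functional g on products from the Boolean recursion of theta,
    where L is a list of elements of C[X] and C[Y].  Boolean cumulants with an
    interior argument 1 lose that argument, and merging two neighbours costs a
    product of cumulants; hence, once cumulants with end points in different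
    algebras are known to vanish, "Delta = 0 on lists starting with a given
    letter" is insensitive to inserting units and to merging neighbours.  It may
    therefore be checked either on monomials or on alternating psi-centered
    lists, where c-freeness makes every cumulant of length >= 2 vanish.

    The definition of E^psi_X by cut points says that Delta = 0 for
    (psi, E^psi_X) on monomials starting with Y, so E^psi_X kills alternating
    centered lists starting with Y.  This gives Delta = 0 for (phi, F) with
    F = phi - phi o E^psi_X on centered lists starting with X, hence on monomials
    starting with X, and that is exactly what is needed to prove
    phi o E = phi by induction along the recursion (iii)-(iv). *)

(** * Boolean cumulants of functionals on lists *)

Section BooleanCumulants.
Variables (T : Type) (K : comNzRingType) (m : seq T -> K).

(* [bpart t s] is the Boolean cumulant whose first argument is the product of
   [t] and whose other arguments are listed by [s]. *)
Fixpoint bpart (t s : seq T) : K :=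
  if s is x :: s' then bpart (rcons t x) s' - m t * bpart [:: x] s' else m t.

Definition cum (s : seq T) : K := if s is x :: s' then bpart [:: x] s' else 0.

Definition conv (V : lmodType K) (f : seq T -> K) (g : seq T -> V) (s : seq T) : V :=
  \sum_(k < (size s).+1) f (take k s) *: g (drop k s).

Lemma conv_nil (V : lmodType K) f (g : seq T -> V) : conv f g [::] = f [::] *: g [::].
Proof. by rewrite /conv big_ord1. Qed.

Lemma conv_cons (V : lmodType K) f (g : seq T -> V) x s :
  conv f g (x :: s) = f [::] *: g (x :: s) + conv (fun u => f (x :: u)) g s.
Proof. by rewrite /conv big_ord_recl. Qed.

Lemma eq_conv (V : lmodType K) (f1 f2 : seq T -> K) (g : seq T -> V) s :
  f1 =1 f2 -> conv f1 g s = conv f2 g s.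
Proof. by move=> e; apply: eq_bigr => k _; rewrite e. Qed.

(** The convolution runs over [s'] only, so every cut leaves at least [x] on its left: this is the
    restriction k >= 1. *)
Definition bdefect (V : lmodType K) (g : seq T -> V) (s : seq T) : V :=
  if s is x :: s' then g s - conv (bpart [:: x]) g s' else 0.

(** The empty prefix gives [m t *: g (x :: s)], and the correction terms of [bpart] subtract [m t]
    times the convolution inside the defect. *)
Lemma conv_bpart_cons (V : lmodType K) (g : seq T -> V) t x s :
  conv (bpart t) g (x :: s) =
  conv (bpart (rcons t x)) g s + m t *: bdefect g (x :: s).
Proof.
rewrite conv_cons /= scalerBr addrCA; congr (_ + _).
rewrite /conv scaler_sumr -sumrB; apply: eq_bigr => k _.
by rewrite scalerBl scalerA.
Qed.

Hypothesis m1 : m [::] = 1.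

Lemma conv_bpart_nil (V : lmodType K) (g : seq T -> V) s : conv (bpart [::]) g s = g s.
Proof.
case: s => [|x s]; first by rewrite conv_nil /= m1 scale1r.
by rewrite conv_bpart_cons m1 scale1r /= addrC subrK.
Qed.

(** By induction the defect of [m] itself is zero. At [t = [:: x]] this is the defining recursion of
    Boolean cumulants. *)
Lemma conv_bpart_moment t s : conv (bpart t) (m : seq T -> K^o) s = m (t ++ s).
Proof.
elim: s t => [|x s IH] t; first by rewrite conv_nil cats0 m1 /= [_ *: _]mulr1.
by rewrite conv_bpart_cons /= !IH subrr scaler0 addr0 cat_rcons.
Qed.

End BooleanCumulants.

Lemma bpart_map (T T' : Type) (K : comNzRingType) (h : T -> T') (m : seq T -> K)
    (m' : seq T' -> K) t s :
  (forall u, m u = m' (map h u)) ->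
  bpart m t s = bpart m' (map h t) (map h s).
Proof.
move=> e; elim: s t => [|x s IH] t /=; first exact: e.
by rewrite !IH e map_rcons.
Qed.

(** * Linear functionals on the free product, under units and merging *)

Section FreeProduct.
Variable K : comNzRingType.
Notation elt := (bool * {poly K})%type.

(* [g] is a linear function of the product of its arguments in the free
   product of K[X] and K[Y]. *)
Definition free_functional (V : lmodType K) (g : seq elt -> V) : Prop :=
  [/\ forall c b a p q r,
        g (c ++ (b, a *: p + q) :: r) = a *: g (c ++ (b, p) :: r) + g (c ++ (b, q) :: r),
      forall c b r, g (c ++ (b, 1) :: r) = g (c ++ r)
    & forall c b p q r, g (c ++ (b, p) :: (b, q) :: r) = g (c ++ (b, p * q) :: r)].

Definition alternating : seq elt -> bool := sorted (fun u v : elt => u.1 != v.1).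

Lemma alternatingPn (L : seq elt) :
  ~~ alternating L -> exists c b p q r, L = c ++ (b, p) :: (b, q) :: r.
Proof.
case: L => // x L; elim: L x => //= y L IH x.
rewrite negb_and negbK => /orP[/eqP e|/IH[c [b [p [q [r e]]]]]].
  by exists [::], x.1, x.2, y.2, L; case: x y e => [? ?] [? ?] /= ->.
by exists (x :: c), b, p, q, r; rewrite e.
Qed.

(** Strong induction on length: equal neighbouring letters are merged, and the entries of an
    alternating list are expanded, from left to right, into good elements and units, which shorten
    the list. The merging premise offers all shorter lists because merging creates products of
    cumulants of sublists. *)
Lemma free_reduction (good : elt -> Prop) (P : seq elt -> Prop) :
  (forall b (Q : {poly K} -> Prop),
     (forall a p q, Q p -> Q q -> Q (a *: p + q)) -> Q 1 ->
     (forall q, good (b, q) -> Q q) -> forall p, Q p) ->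
  (forall c b a p q r,
     P (c ++ (b, p) :: r) -> P (c ++ (b, q) :: r) -> P (c ++ (b, a *: p + q) :: r)) ->
  (forall c b r, P (c ++ r) -> P (c ++ (b, 1) :: r)) ->
  (forall c b p q r,
     (forall L, (size L <= size (c ++ (b, q) :: r))%N -> P L) ->
     P (c ++ (b, p) :: (b, q) :: r)) ->
  (forall L, alternating L -> (forall u, u \in L -> good u) -> P L) ->
  forall L, P L.
Proof.
move=> span Plin Punit Pmerge Pbase L.
have [n] := ubnP (size L); elim: n L => // n IH L; rewrite ltnS => leLn.
case: (boolP (alternating L)) => [altL|]; last first.
  case/alternatingPn=> c [b [p [q [r eL]]]]; rewrite eL; apply: Pmerge => L' leL'.
  apply: IH; apply: leq_ltn_trans leL' _; apply: leq_trans leLn.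
  by rewrite eL !size_cat /= !addnS ltnS.
(* [c] is the prefix whose entries are already good. *)
suff H : forall r c, (forall u, u \in c -> good u) -> (size (c ++ r) <= n)%N ->
    alternating (c ++ r) -> P (c ++ r).
  exact: (H L [::]).
elim=> {L leLn altL} [|[b p] r IHr] c cgood len altL.
  by rewrite cats0 in altL *; exact: Pbase.
move: p len altL; apply: (span b (fun p => (size (c ++ (b, p) :: r) <= n)%N ->
  alternating (c ++ (b, p) :: r) -> P (c ++ (b, p) :: r))).
- have e p q : alternating (c ++ (b, p) :: r) = alternating (c ++ (b, q) :: r).
    have h (L : seq elt) : alternating L = sorted (fun u v => u != v) (map fst L).
      by rewrite sorted_map.
    by rewrite !h !map_cat.
  move=> a p q hp hq len alt; apply: Plin.
    by apply: hp; [move: len; rewrite !size_cat | rewrite (e _ (a *: p + q))].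
  by apply: hq; [move: len; rewrite !size_cat | rewrite (e _ (a *: p + q))].
- move=> len _; apply: Punit; apply: IH; apply: leq_trans len.
  by rewrite !size_cat /= addnS.
- move=> q gq len altL; rewrite -cat_rcons; apply: IHr; rewrite ?cat_rcons //.
  by move=> u; rewrite mem_rcons inE => /orP[/eqP->|/cgood].
Qed.

(** The first block enters only through the moments [m (t ++ _)], so units and merges inside it are
    invisible. *)
Lemma bpart_ext (m : seq elt -> K) t t' s :
  (forall u, m (t ++ u) = m (t' ++ u)) -> bpart m t s = bpart m t' s.
Proof.
elim: s t t' => [|x s IH] t t' e /=; first by have := e [::]; rewrite !cats0.
rewrite (IH (rcons t x) (rcons t' x)); last by move=> u; rewrite !cat_rcons.
by have := e [::]; rewrite !cats0 => ->.
Qed.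

Section Cumulants.
Variables (m : seq elt -> K).
Hypotheses (mfree : free_functional (m : seq elt -> K^o)) (m1 : m [::] = 1).

Lemma moment_lin c b a p q r :
  m (c ++ (b, a *: p + q) :: r) = a * m (c ++ (b, p) :: r) + m (c ++ (b, q) :: r).
Proof. by case: mfree => h _ _; rewrite h. Qed.

Lemma moment_unit c b r : m (c ++ (b, 1) :: r) = m (c ++ r).
Proof. by case: mfree. Qed.

Lemma moment_merge c b p q r :
  m (c ++ (b, p) :: (b, q) :: r) = m (c ++ (b, p * q) :: r).
Proof. by case: mfree. Qed.

Lemma bpart_head_lin c b a p q r s :
  bpart m (c ++ (b, a *: p + q) :: r) s =
  a * bpart m (c ++ (b, p) :: r) s + bpart m (c ++ (b, q) :: r) s.
Proof.
elim: s r => [|x s IH] r /=; first exact: moment_lin.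
rewrite !rcons_cat !rcons_cons IH moment_lin mulrBr mulrDl !mulrA opprD.
by rewrite addrACA.
Qed.

Lemma bpart_lin t c b a p q r :
  bpart m t (c ++ (b, a *: p + q) :: r) =
  a * bpart m t (c ++ (b, p) :: r) + bpart m t (c ++ (b, q) :: r).
Proof.
elim: c t => [|x c IH] t /=; last first.
  by rewrite !IH mulrDr mulrBr opprD addrACA mulrCA.
rewrite -!cats1 bpart_head_lin (bpart_head_lin [::]).
by rewrite mulrDr mulrBr opprD addrACA mulrCA.
Qed.

Lemma bpart_unit_head b x s : bpart m [:: (b, 1)] (x :: s) = 0.
Proof.
rewrite /= (moment_unit [::]) m1 mul1r (@bpart_ext _ _ [:: x]) ?subrr // => u.
exact: (moment_unit [::]).
Qed.

(** The [x] after the unit makes it interior: the product subtracted by the recursion then has a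
    factor headed by 1 with a further argument, which is zero. *)
Lemma bpart_unit t c b x r :
  bpart m t (c ++ (b, 1) :: x :: r) = bpart m t (c ++ x :: r).
Proof.
elim: c t => [|y c IH] t; last by rewrite /= !IH.
rewrite cat0s [LHS]/=-/(bpart m [:: (b, 1)] (x :: r)) bpart_unit_head mulr0 subr0.
rewrite /= -!cats1 -catA moment_unit cats0; congr (_ - _).
by apply: bpart_ext => u; rewrite -!catA moment_unit.
Qed.

Lemma bpart_unit_last t c b : bpart m t (c ++ [:: (b, 1)]) = 0.
Proof.
elim: c t => [|y c IH] t /=; last by rewrite !IH mulr0 subrr.
by rewrite -cats1 (moment_unit [::]) moment_unit cats0 m1 mulr1 subrr.
Qed.

Lemma bpart_merge_head b p q s :
  bpart m [:: (b, p)] ((b, q) :: s) =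
  bpart m [:: (b, p * q)] s - m [:: (b, p)] * bpart m [:: (b, q)] s.
Proof.
rewrite /=; congr (_ - _); apply: bpart_ext => u.
exact: (moment_merge [::]).
Qed.

(** Separate arguments admit a cut between [p] and [q] that the merged argument does not; the
    product of cumulants accounts for it. *)
Lemma bpart_merge t c b p q r :
  bpart m t (c ++ (b, p) :: (b, q) :: r) =
  bpart m t (c ++ (b, p * q) :: r)
  - bpart m t (rcons c (b, p)) * bpart m [:: (b, q)] r.
Proof.
elim: c t => [|y c IH] t.
  rewrite !cat0s [LHS]/= -/(bpart m [:: (b, p)] ((b, q) :: r)) bpart_merge_head /=.
  have -> : bpart m (rcons (rcons t (b, p)) (b, q)) r = bpart m (rcons t (b, p * q)) r.
    by apply: bpart_ext => u; rewrite !cat_rcons moment_merge.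
  set A := bpart m _ r; set B := bpart m _ r; set D := bpart m [:: (b, q)] r.
  by rewrite mulrBl mulrBr !mulrA opprD !opprK addrACA opprD opprK addrACA.
rewrite /= !IH; set A := bpart m _ _; set B := bpart m _ _.
by rewrite mulrBl mulrBr !mulrA !opprD !opprK addrACA.
Qed.

Variables (V : lmodType K) (g : seq elt -> V).
Hypothesis gfree : free_functional g.

Lemma conv_ext t t' s : (forall u, m (t ++ u) = m (t' ++ u)) ->
  conv (bpart m t) g s = conv (bpart m t') g s.
Proof. by move=> e; apply: eq_conv => u; apply: bpart_ext. Qed.

(** Unlike a single cumulant, the convolution drops a unit in any position, even the last: peeling
    it off leaves a defect headed by 1, which is zero. *)
Lemma conv_unit t c b r :
  conv (bpart m t) g (c ++ (b, 1) :: r) = conv (bpart m t) g (c ++ r).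
Proof.
have [_ gunit _] := gfree.
elim: c t => [|y c IH] t; last by rewrite !cat_cons !conv_bpart_cons !IH /= IH -!cat_cons gunit.
rewrite cat0s conv_bpart_cons /= (gunit [::]) (@conv_ext [:: (b, 1)] [::]); last first.
  exact: (moment_unit [::]).
rewrite conv_bpart_nil // subrr scaler0 addr0; apply: conv_ext => u.
by rewrite cat_rcons moment_unit.
Qed.

Lemma bdefect_unit_head b r : bdefect m g ((b, 1) :: r) = 0.
Proof.
have [_ gunit _] := gfree.
rewrite /= (gunit [::]) (@conv_ext [:: (b, 1)] [::]); last exact: (moment_unit [::]).
by rewrite conv_bpart_nil // subrr.
Qed.

Lemma bdefect_unit x c b r :
  bdefect m g (x :: c ++ (b, 1) :: r) = bdefect m g (x :: c ++ r).
Proof. by have [_ gunit _] := gfree; rewrite /= conv_unit -!cat_cons gunit. Qed.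

Lemma bdefect_merge_head b p q r :
  bdefect m g ((b, p) :: (b, q) :: r) =
  bdefect m g ((b, p * q) :: r) - m [:: (b, p)] *: bdefect m g ((b, q) :: r).
Proof.
have [_ _ gmerge] := gfree; rewrite [LHS]/= conv_bpart_cons opprD addrA.
rewrite (gmerge [::]); congr (_ - _ - _); apply: conv_ext => u.
exact: (moment_merge [::]).
Qed.

(** The prefixes containing [q] are merged at the cost of the products in [bpart_merge]; these and
    the prefix ending at [p] add up to the defect of the list starting at [q]. *)
Lemma conv_merge t c b p q r :
  conv (bpart m t) g (c ++ (b, p) :: (b, q) :: r) =
  conv (bpart m t) g (c ++ (b, p * q) :: r)
  + bpart m t (rcons c (b, p)) *: bdefect m g ((b, q) :: r).
Proof.
have [_ _ gmerge] := gfree.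
elim: c t => [|y c IH] t.
  rewrite !cat0s !conv_bpart_cons bdefect_merge_head.
  move: (bdefect m g ((b, p * q) :: r)) (bdefect m g ((b, q) :: r)) => A B.
  rewrite (@conv_ext (rcons (rcons _ _) _) (rcons t (b, p * q))); last first.
    by move=> u; rewrite !cat_rcons moment_merge.
  rewrite /= scalerBr scalerA scalerBl -!addrA; congr (_ + _).
  by rewrite addrCA.
rewrite !cat_cons !conv_bpart_cons IH -!addrA; congr (_ + _).
have -> : bdefect m g (y :: c ++ [:: (b, p), (b, q) & r]) =
    bdefect m g (y :: c ++ (b, p * q) :: r)
    - bpart m [:: y] (rcons c (b, p)) *: bdefect m g ((b, q) :: r).
  by rewrite /= -cat_cons gmerge IH opprD addrA.
move: (bdefect m g (y :: _)) (bdefect m g ((b, q) :: r)) => A B.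
by rewrite /= scalerBr scalerA scalerBl addrCA.
Qed.

Lemma bdefect_merge x c b p q r :
  bdefect m g (x :: c ++ (b, p) :: (b, q) :: r) =
  bdefect m g (x :: c ++ (b, p * q) :: r)
  - bpart m [:: x] (rcons c (b, p)) *: bdefect m g ((b, q) :: r).
Proof.
have [_ _ gmerge] := gfree.
by rewrite /= conv_merge -!cat_cons gmerge /= opprD addrA.
Qed.

Lemma bdefect_lin c b a p q r :
  bdefect m g (c ++ (b, a *: p + q) :: r) =
  a *: bdefect m g (c ++ (b, p) :: r) + bdefect m g (c ++ (b, q) :: r).
Proof.
have [glin _ _] := gfree.
case: c => [|x c].
  rewrite /= (glin [::]) scalerBr addrACA -opprD; congr (_ - _).
  rewrite /conv scaler_sumr -big_split; apply: eq_bigr => k _ /=.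
  by rewrite (bpart_head_lin [::]) scalerDl scalerA.
rewrite /= -!cat_cons glin /= scalerBr addrACA -opprD; congr (_ - _).
(* The first block is generalized because the induction hypothesis is needed both at [rcons t y] and
   at [[:: y]]. *)
elim: c [:: x] => [|y c IH] t.
  rewrite !cat0s !conv_cons (glin [::]) scalerDr scalerDr !scalerA mulrC -!scalerA.
  rewrite addrACA; congr (_ + _).
  rewrite /conv scaler_sumr -big_split; apply: eq_bigr => k _ /=.
  rewrite -!cats1 bpart_head_lin (bpart_head_lin [::]) scalerA -scalerDl.
  by congr (_ *: _); rewrite mulrDr mulrBr opprD addrACA mulrCA.
have lin_y : bdefect m g (y :: c ++ (b, a *: p + q) :: r) =
    a *: bdefect m g (y :: c ++ (b, p) :: r) + bdefect m g (y :: c ++ (b, q) :: r).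
  by rewrite /= IH -cat_cons glin scalerBr addrACA opprD.
rewrite !cat_cons !conv_bpart_cons IH lin_y.
move: (bdefect m g _) (bdefect m g _) => A B.
by rewrite !scalerDr scalerA mulrC -scalerA addrACA.
Qed.

End Cumulants.
End FreeProduct.

(** * Centered elements and cumulants with end points in different algebras *)

Section CFreeness.
Variable K : comNzRingType.
Notation elt := (bool * {poly K})%type.

Definition spanning (good : elt -> Prop) : Prop :=
  forall b (Q : {poly K} -> Prop),
    (forall a p q, Q p -> Q q -> Q (a *: p + q)) -> Q 1 ->
    (forall q, good (b, q) -> Q q) -> forall p, Q p.

Lemma spanning_monomials : spanning (fun u => exists k, u.2 = 'X^(k.+1)).
Proof.
move=> b Q Qlin Q1 Qgood p.
have Q0 : Q 0 by have := Qlin (-1) 1 1 Q1 Q1; rewrite scaleN1r addNr.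
rewrite -[p]coefK poly_def; elim/big_ind: _ => // [u v Qu Qv|i _].
  by have := Qlin 1 u v Qu Qv; rewrite scale1r.
rewrite -[_ *: _]addr0; apply: Qlin => //; case: (nat_of_ord i) => [|k].
  by rewrite expr0.
by apply: Qgood; exists k.
Qed.

Lemma spanning_centered (n : seq elt -> K) :
  free_functional (n : seq elt -> K^o) -> n [::] = 1 ->
  spanning (fun u => n [:: u] = 0).
Proof.
move=> nfree n1 b Q Qlin Q1 Qgood p; pose c := n [:: (b, p)].
have -> : p = c *: 1 + (- c *: 1 + p) by rewrite scaleNr addrA subrr add0r.
apply: (Qlin _ _ _ Q1); apply: Qgood.
by rewrite (moment_lin nfree [::]) (moment_unit nfree [::]) n1 mulr1 addNr.
Qed.

(** Only the end points are compared: a cumulant such as beta(X, Y, X) need not vanish. *)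
Definition mixed_vanish (m : seq elt -> K) : Prop :=
  forall x s, x.1 != (last x s).1 -> bpart m [:: x] s = 0.

(** The class [good] will be the positive powers or the psi-centered elements. The default head
    [(~~ l, 0)] excludes the empty list. *)
Lemma bdefect_vanish (m : seq elt -> K) (V : lmodType K) (g : seq elt -> V)
    (good : elt -> Prop) (l : bool) :
  free_functional (m : seq elt -> K^o) -> m [::] = 1 -> mixed_vanish m ->
  free_functional g -> spanning good ->
  (forall L, alternating L -> (forall u, u \in L -> good u) ->
     (head (~~ l, 0) L).1 = l -> bdefect m g L = 0) ->
  forall L, (head (~~ l, 0) L).1 = l -> bdefect m g L = 0.
Proof.
move=> mfree m1 mixed gfree span base.
apply: (free_reduction span) => //.
- move=> c b a p q r; rewrite (bdefect_lin mfree gfree).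
  by case: c => [|x c] /= hp hq h; rewrite hp // hq // scaler0 addr0.
- move=> [|x c] b r; first by rewrite (bdefect_unit_head mfree m1 gfree).
  by rewrite !cat_cons (bdefect_unit mfree m1 gfree).
- move=> [|x c] b p q r IH /= e; subst l.
    rewrite -/(bdefect m g ((b, p) :: (b, q) :: r)).
    by rewrite (bdefect_merge_head mfree gfree) !IH //= scaler0 subr0.
  rewrite -/(bdefect m g (x :: c ++ (b, p) :: (b, q) :: r)).
  rewrite (bdefect_merge mfree gfree) IH //= ?size_cat //= sub0r.
  (* The correction term is a cumulant from [x] to [p] times the defect from [q]. If the letters of
     [x] and [p] differ, the cumulant vanishes; otherwise the shorter list starts with the same
     letter as the whole, and induction applies. *)
  have [e|ne] := eqVneq x.1 b; last by rewrite mixed ?scale0r ?oppr0 // last_rcons.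
  rewrite -/(bdefect m g ((b, q) :: r)) IH ?scaler0 ?oppr0 //.
  by rewrite size_cat /= addnS ltnS leq_addl.
Qed.

Variables m n : seq elt -> K.
Hypotheses (mfree : free_functional (m : seq elt -> K^o)) (m1 : m [::] = 1).
Hypotheses (nfree : free_functional (n : seq elt -> K^o)) (n1 : n [::] = 1).
Hypothesis m_cfree : forall L, alternating L ->
  (forall u, u \in L -> n [:: u] = 0) -> m L = \prod_(u <- L) m [:: u].

(** On such lists [m] is multiplicative, so a cumulant of two arguments is a product minus itself;
    longer ones reduce to it. *)
Lemma bpart_centered t x s : t != [::] -> alternating (t ++ x :: s) ->
  (forall u, u \in t ++ x :: s -> n [:: u] = 0) -> bpart m t (x :: s) = 0.
Proof.
elim: s t x => [|y s IH] t x t0 alt cen.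
  rewrite /= -cats1 !m_cfree ?big_cat ?subrr //.
  - by move=> u us; apply: cen; rewrite mem_cat us orbT.
  - by have [] := cat_sorted2 alt.
  - by move=> u ut; apply: cen; rewrite mem_cat ut.
rewrite [LHS]/= -/(bpart m (rcons t x) (y :: s)) -/(bpart m [:: x] (y :: s)).
rewrite IH ?cat_rcons //; last by case: (t).
rewrite IH ?mulr0 ?subrr //.
  by have [] := cat_sorted2 alt.
by move=> u us; apply: cen; rewrite mem_cat us orbT.
Qed.

Lemma cfree_mixed_vanish : mixed_vanish m.
Proof.
pose P (L : seq elt) :=
  if L is x :: s then x.1 != (last x s).1 -> bpart m [:: x] s = 0 else True.
suff H L : P L by move=> x s; exact: (H (x :: s)).
move: L; apply: (free_reduction (spanning_centered nfree n1)).
- case=> [|x c] b a p q r /= hp hq h.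
    by rewrite (bpart_head_lin mfree [::]) hp ?hq ?mulr0 ?addr0 //; move: h; case: r {hp hq}.
  rewrite (bpart_lin mfree) hp ?hq ?mulr0 ?addr0 //; move: h; rewrite !last_cat /=;
    by case: r {hp hq}.
- case=> [|x c] b [|y r] /=.
  + by rewrite eqxx.
  + by move=> _ _; exact: (bpart_unit_head mfree m1).
  + by move=> _ _; exact: (bpart_unit_last mfree m1).
  + by rewrite (bpart_unit mfree m1) !last_cat.
- case=> [|x c] b p q r IH.
    move=> h; rewrite (bpart_merge_head mfree).
    have h1 := IH ((b, p * q) :: r); rewrite h1 //=; last first.
      by move: h; rewrite /=; case: (r).
    have h2 := IH ((b, q) :: r); rewrite h2 ?mulr0 ?subrr //=.
  rewrite /P cat_cons (bpart_merge mfree) last_cat => h.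
  have -> : bpart m [:: x] (c ++ (b, p * q) :: r) = 0.
    apply: (IH (x :: c ++ (b, p * q) :: r)); first by rewrite /= !size_cat.
    by move: h; rewrite last_cat /=; case: (r).
  (* One of the two factors always has end points in different algebras: the right one if [x] and
     [p] share their letter, the left one otherwise. *)
  rewrite sub0r; have [e|ne] := eqVneq x.1 b.
    rewrite (IH ((b, q) :: r)) ?mulr0 ?oppr0 //=.
      by rewrite size_cat /= addnS ltnS leqW ?leq_addl.
    by move: h; rewrite /= e.
  rewrite (IH (x :: rcons c (b, p))) ?mul0r ?oppr0 //.
    by rewrite /= size_rcons size_cat /= addnS ltnS leq_addr.
  by rewrite last_rcons.
- case=> [|x [|y s]] //=; first by rewrite eqxx.
  by move=> alt cen _; apply: (@bpart_centered [:: x]).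
Qed.

End CFreeness.

(** * From functions on words to functionals on lists of polynomials *)

Notation elt := (bool * {poly C})%type.

Section Lifting.
Variable V : lmodType C.
Implicit Types (f : word -> V) (h : nat -> V) (L : seq elt).

(** The linear extension of the assignment of [h k] to ['X^k]. *)
Definition psum h (p : {poly C}) : V := \sum_(k < size p) p`_k *: h k.

Lemma psum_widen h (p : {poly C}) N :
  (size p <= N)%N -> psum h p = \sum_(k < N) p`_k *: h k.
Proof.
move=> le; rewrite /psum (big_ord_widen _ (fun k => p`_k *: h k) le).
rewrite [RHS](bigID (fun k : 'I_N => (k < size p)%N)) /= [X in _ + X]big1 ?addr0 //.
by move=> k; rewrite -leqNgt => lek; rewrite nth_default ?scale0r.
Qed.

Lemma psum_lin h a p q : psum h (a *: p + q) = a *: psum h p + psum h q.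
Proof.
pose N := maxn (size p) (size q).
have ple : (size p <= N)%N by rewrite leq_maxl.
have qle : (size q <= N)%N by rewrite leq_maxr.
have les : (size (a *: p + q)%R <= N)%N.
  apply: leq_trans (size_polyD _ _) _; rewrite geq_max qle andbT.
  by apply: leq_trans (size_scale_leq _ _) ple.
rewrite !(@psum_widen _ _ N) // scaler_sumr -big_split; apply: eq_bigr => k _ /=.
by rewrite coefD coefZ scalerDl scalerA.
Qed.

Lemma psum_Xn h k : psum h 'X^k = h k.
Proof.
rewrite /psum size_polyXn big_ord_recr /= coefXn eqxx scale1r big1 ?add0r // => i _.
by rewrite coefXn ltn_eqF ?scale0r.
Qed.

Lemma eq_psum h1 h2 p : h1 =1 h2 -> psum h1 p = psum h2 p.
Proof. by move=> e; apply: eq_bigr => k _; rewrite e. Qed.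

Lemma psum_sum h1 h2 a p :
  psum (fun k => a *: h1 k + h2 k) p = a *: psum h1 p + psum h2 p.
Proof.
rewrite scaler_sumr -big_split; apply: eq_bigr => k _ /=.
by rewrite scalerDr !scalerA mulrC.
Qed.

Lemma poly_span_ind (Q : {poly C} -> Prop) :
  (forall a p q, Q p -> Q q -> Q (a *: p + q)) -> (forall k, Q 'X^k) -> forall p, Q p.
Proof.
move=> Qlin QX; apply: (@spanning_monomials _ true) => //.
  by have := QX 0; rewrite expr0.
by move=> q [k /= ->].
Qed.

Lemma psum_mul h p q : psum (fun i => psum (fun j => h (i + j)%N) q) p = psum h (p * q).
Proof.
elim/poly_span_ind: p => [a p p' IH IH'|i].
  by rewrite psum_lin IH IH' mulrDl -scalerAl psum_lin.
rewrite psum_Xn; elim/poly_span_ind: q => [a q q' IH IH'|j].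
  by rewrite psum_lin IH IH' mulrDr -scalerAr psum_lin.
by rewrite psum_Xn -exprD psum_Xn.
Qed.

Definition lsum f (P : ncpoly) : V := \sum_(cw <- P) cw.1 *: f cw.2.
Definition wlift f L : V := lsum f (prodnc L).

Lemma lsum_mul f P Q :
  lsum f (ncmul P Q) = lsum (fun v => lsum (fun w => f (v ++ w)) Q) P.
Proof.
rewrite /lsum /ncmul big_allpairs_dep; apply: eq_bigr => a _.
by rewrite scaler_sumr; apply: eq_bigr => b _; rewrite scalerA.
Qed.

Lemma lsum_emb f b p : lsum f (emb b p) = psum (fun k => f (nseq k b)) p.
Proof.
rewrite /lsum /emb big_map /psum -(big_mkord xpredT (fun k => p`_k *: f (nseq k b))).
by rewrite /index_iota subn0.
Qed.

Lemma wlift_nil f : wlift f [::] = f [::].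
Proof. by rewrite /wlift /lsum big_seq1 scale1r. Qed.

Lemma wlift_cons f b p L :
  wlift f ((b, p) :: L) = psum (fun k => wlift (fun w => f (nseq k b ++ w)) L) p.
Proof. by rewrite /wlift /= lsum_mul lsum_emb. Qed.

Lemma eq_wlift f1 f2 L : f1 =1 f2 -> wlift f1 L = wlift f2 L.
Proof. by move=> e; apply: eq_bigr => k _; rewrite e. Qed.

(** The prefix [c] is absorbed into [f] entry by entry, so only the head position needs an
    argument. *)
Lemma wlift_free f : free_functional (wlift f).
Proof.
split=> [c b a p q r|c b r|c b p q r]; elim: c f => [|[l u] c IH] f.
- by rewrite !cat0s !wlift_cons psum_lin.
- rewrite !cat_cons !wlift_cons -psum_sum; apply: eq_psum => k; exact: IH.
- by rewrite cat0s wlift_cons -(expr0 'X) psum_Xn.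
- by rewrite !cat_cons !wlift_cons; apply: eq_psum => k; exact: IH.
- rewrite !cat0s !wlift_cons -psum_mul; apply: eq_psum => i; rewrite wlift_cons.
  by apply: eq_psum => j; apply: eq_wlift => w; rewrite catA -nseqD.
- by rewrite !cat_cons !wlift_cons; apply: eq_psum => k; exact: IH.
Qed.

Definition mono (u : bool * nat) : elt := (u.1, 'X^(u.2)).
Definition pow (u : bool * nat) : word := nseq u.2 u.1.

Lemma wlift_mono f (s : seq (bool * nat)) : wlift f (map mono s) = f (flatten (map pow s)).
Proof.
by elim: s f => [|u s IH] f /=; rewrite ?wlift_nil // wlift_cons psum_Xn IH.
Qed.

End Lifting.

Lemma wlift_comp (V W : lmodType C) (h : {linear V -> W}) (f : word -> V) L :
  wlift (fun w => h (f w)) L = h (wlift f L).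
Proof. by rewrite linear_sum; apply: eq_bigr => a _; rewrite linearZ. Qed.

Lemma wlift_sub (V : lmodType C) (f g : word -> V) L :
  wlift (fun w => f w - g w) L = wlift f L - wlift g L.
Proof. by rewrite -sumrB; apply: eq_bigr => a _; rewrite scalerBr. Qed.

(** * Moments and block factorizations of words *)

Definition mom (theta : word -> C) (L : seq elt) : C := wlift (theta : word -> C^o) L.

Lemma mom_free theta : free_functional (mom theta : seq elt -> C^o).
Proof. exact: wlift_free. Qed.

Lemma mom_nil theta : mom theta [::] = theta [::].
Proof. exact: wlift_nil. Qed.

Lemma bcum_cum (theta : word -> C) s : theta [::] = 1 ->
  bcum theta s = cum (fun u => theta (flatten u)) s.
Proof.
move=> th1; case: s => // x s; rewrite /bcum.
set m := fun u => _.
suff H n y r : (size r < n)%N -> bcum_aux theta n (y :: r) = cum m (y :: r) by exact: H.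
elim: n y r => [|n IH] y r //; rewrite ltnS => le.
(* The last term of this convolution is the full cumulant, as [m [::] = 1]; isolating it gives the
   recursion that [bcum_aux] runs. *)
have := @conv_bpart_moment _ _ m th1 [:: y] r.
rewrite /conv big_ord_recr /= take_size drop_size => e.
have -> : bpart m [:: y] r = m (y :: r) -
    \sum_(k < size r) bpart m [:: y] (take k r) * m (drop k r).
  by rewrite [m _]/= in e *; rewrite -e addrAC subrr add0r /m /= th1 [_ *: _]mulr1.
congr (_ - _); rewrite big_add1 big_mkord; apply: eq_bigr => k _ /=.
by rewrite IH ?size_takel ?(leq_trans (ltn_ord k) le) // ltnW.
Qed.

Lemma bcum_pow (theta : word -> C) s : theta [::] = 1 ->
  bcum theta (map pow s) = cum (mom theta) (map mono s).
Proof.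
move=> th1; rewrite bcum_cum //; case: s => //= u s.
pose m v := theta (flatten (map pow v)).
rewrite -(@bpart_map _ _ _ pow m _ [:: u]) //.
by rewrite -(@bpart_map _ _ _ mono m _ [:: u]) // => v; rewrite /mom wlift_mono.
Qed.

(* The pair [(l, k)] stands for the block l^k, and [runs] says that a list of
   pairs is a block factorization. *)
Definition runs (s : seq (bool * nat)) : bool :=
  sorted (fun u v => u.1 != v.1) s && all (fun u => 0 < u.2)%N s.

Definition unrun (s : seq (bool * nat)) : word := flatten (map pow s).

Lemma runs_cat s t : runs (s ++ t) -> runs s && runs t.
Proof.
case/andP=> /cat_sorted2 [h1 h2]; rewrite all_cat => /andP[h3 h4].
by rewrite /runs h1 h2 h3 h4.
Qed.

Lemma runs_cons x s : runs (x :: s) -> runs s.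
Proof. by rewrite -cat1s => /runs_cat /andP[]. Qed.

Lemma runs_pos b n s : runs ((b, n) :: s) -> (0 < n)%N.
Proof. by case/andP=> _ /= /andP[]. Qed.

Lemma alternating_mono s : alternating (map mono s) = sorted (fun u v => u.1 != v.1) s.
Proof. by rewrite /alternating sorted_map. Qed.

Lemma runs_incr b n s : runs ((b, n) :: s) -> runs ((b, n.+1) :: s).
Proof. by rewrite /runs /= => /andP[h1 /andP[_ ->]]; rewrite andbT; case: s h1. Qed.

Lemma ex_runs W : exists2 s, runs s & W = unrun s.
Proof.
elim: W => [|a W [[|[b n] s] rs ->]]; first by exists [::].
  by exists [:: (a, 1%N)].
have [e|ne] := eqVneq a b.
  by exists ((b, n.+1) :: s); [exact: runs_incr | rewrite e].
exists ((a, 1%N) :: (b, n) :: s) => //.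
by move: rs; rewrite /runs /= ne.
Qed.

Lemma unrun_cat s t : unrun (s ++ t) = unrun s ++ unrun t.
Proof. by rewrite /unrun map_cat flatten_cat. Qed.

Lemma unrun_cons b n s : unrun ((b, n) :: s) = nseq n b ++ unrun s.
Proof. by []. Qed.

Lemma head_unrun a x s : runs (x :: s) -> head a (unrun (x :: s)) = x.1.
Proof. by case: x => b [|n] // /runs_pos. Qed.

(** The default [~~ b] lets the premise hold for an empty remainder. *)
Lemma blocks_nseq b n w : head (~~ b) w != b ->
  blocks (nseq n.+1 b ++ w) = nseq n.+1 b :: blocks w.
Proof.
have nz v : blocks v != [::] -> nilp (head [::] (blocks v)) = false.
  by case: v => //= c v _; case: (blocks v) => [|[|d u] r] //; case: ifP.
move=> hw; elim: n => [|n IH] /=.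
  case: w hw => [|c w] //= ne; case: (blocks w) => [|[|d u] r] //=.
  - by rewrite (negPf ne).
  - by rewrite (negPf ne).
  - by case: eqVneq => [->|_] /=; rewrite (negPf ne).
by move: IH => /= ->; rewrite eqxx.
Qed.

Lemma blocks_unrun s : runs s -> blocks (unrun s) = map pow s.
Proof.
elim: s => [|[b [|n]] s IH] // rs; first by have := runs_pos rs.
 rewrite unrun_cons blocks_nseq ?IH ?(runs_cons rs) //.
case: s rs {IH} => [|y s] rs; first by rewrite /=; case: b {rs}.
by rewrite head_unrun ?(runs_cons rs) //; case/andP: rs => /= /andP[]; rewrite eq_sym.
Qed.

Lemma last_unrun a x s : runs (x :: s) -> last a (unrun (x :: s)) = (last x s).1.
Proof.
elim: s a x => [|y s IH] a [b n] rs.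
  by rewrite unrun_cons cats0; case: n rs => [/runs_pos|n _] //=; elim: n.
by rewrite unrun_cons last_cat IH // (runs_cons rs).
Qed.

(** * Sums over factorizations of a word as convolutions over its blocks *)

Section BlockSums.
Variables (theta : word -> C).
Hypotheses (th1 : theta [::] = 1) (mixed : mixed_vanish (mom theta)).

(** If the end letters differ, [bb] is zero by definition and the cumulant by [mixed]. *)
Lemma bb_unrun x s : runs (x :: s) ->
  bb theta x.1 (unrun (x :: s)) = cum (mom theta) (map mono (x :: s)).
Proof.
move=> rs; have la := last_unrun x.1 rs; have ha := head_unrun x.1 rs.
have bl := blocks_unrun rs; move: la ha bl; rewrite /bb.
case: (unrun (x :: s)) => [|a w] /=; first by case: x rs => ? [] // /runs_pos.
move=> la ha bl; rewrite bl la ha eqxx /=.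
case: eqP => [_|/eqP ne].
  by rewrite -[pow x :: _]/(map pow (x :: s)) bcum_pow.
by rewrite mixed //= last_map eq_sym.
Qed.

Lemma bb_last_neq l w : w != [::] -> last l w != l -> bb theta l w = 0.
Proof. by case: w => //= a w _ h; rewrite (negPf h) andbF. Qed.

Lemma bb_head_neq l a w : a != l -> bb theta l (a :: w) = 0.
Proof. by move=> h; rewrite /= (negPf h). Qed.

Variables (V : lmodType C).

(** [dtens] with values in any module, so that scalar functionals obey the same lemmas. *)
Definition dsum (l : bool) (f : word -> C) (g : word -> V) (W : word) : V :=
  \sum_(i < size W | nth l W i == l) f (take i W) *: g (drop i W).

(** A cut strictly inside a block of letter [~~ x.1] leaves a left factor ending in that letter,
    where [bb] vanishes, so only cuts between blocks count. [t] lists the blocks already passed, and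
    the isolated summand is the cut at the end of the word. *)
Lemma dsum_conv_prefix (g : word -> V) x t s : runs (x :: t ++ s) ->
  bb theta x.1 (unrun (x :: t ++ s)) *: g [::] +
  dsum (~~ x.1) (fun w => bb theta x.1 (unrun (x :: t) ++ w)) g (unrun s) =
  conv (fun u => cum (mom theta) (map mono (x :: t) ++ u)) (wlift g) (map mono s).
Proof.
elim: s t => [|[b n] s IH] t rs.
  rewrite conv_nil wlift_nil cats0 bb_unrun; last by move: rs; rewrite cats0.
  by rewrite /dsum big_ord0 addr0 !cats0.
have := IH (rcons t (b, n)); rewrite cat_rcons => /(_ rs) {}IH.
rewrite /= conv_cons cats0.
have -> : conv (fun u => bpart (mom theta) [:: mono x] (map mono t ++ mono (b, n) :: u))
     (wlift g) (map mono s) =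
   conv (fun u : seq elt => cum (mom theta) (map mono (x :: rcons t (b, n)) ++ u)) (wlift g)
         (map mono s).
  by apply: eq_conv => u; rewrite /= map_rcons cat_rcons.
rewrite -IH addrCA; congr (_ + _); rewrite -map_cons wlift_mono -/(unrun _).
rewrite /dsum unrun_cons size_cat big_split_ord /=; congr (_ + _).
- rewrite size_nseq; case: n rs {IH} => [|n] rs.
    by move: rs; rewrite -cat_cons => /runs_cat /andP[_ /runs_pos].
  have e : (bpart (mom theta) [:: mono x] (map mono t)) = bb theta x.1 (unrun (x :: t)).
    by rewrite bb_unrun // ; move: rs; rewrite -cat_cons => /runs_cat /andP[].
  (* A block of letter [x.1] offers no cut on the left-hand side; on the right, the cumulant ends in
     the preceding block, of the other letter, and vanishes. *)
  rewrite e; have [ebx|nebx] := eqVneq b (~~ x.1); last first.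
    rewrite big1 => [|i]; last by rewrite nth_cat size_nseq ltn_ord nth_nseq ltn_ord (negPf nebx).
    rewrite -e mixed ?scale0r // last_map.
    move: rs => /andP[] /=. rewrite cat_path => /andP[_ /= /andP[+ _]] _.
    by rewrite negb_eqb addbC; move: nebx; case: (b); case: (x.1); case: (last x t).1.
  rewrite big_mkcond big_ord_recl /= ebx eqxx cats0 big1 ?addr0 // => i _.
  case: ifP => // _; rewrite bb_last_neq ?scale0r //.
    by case: (unrun _).
  rewrite last_cat /= add0n takel_cat ?size_nseq 1?ltnW // take_nseq 1?ltnW //.
  have -> k c : last c (nseq k c) = c by elim: k.
  by case: (x.1).
- apply: eq_big => i; rewrite ?nth_cat ?take_cat ?drop_cat size_nseq ltnNge leq_addr addKn //=.
  move=> _.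
  by rewrite -rcons_cons -cats1 unrun_cat unrun_cons cats0 catA.
Qed.

Lemma dsum_conv (g : word -> V) x s : runs (x :: s) ->
  bb theta x.1 (unrun (x :: s)) *: g [::] +
  dsum (~~ x.1) (bb theta x.1) g (unrun (x :: s)) =
  conv (bpart (mom theta) [:: mono x]) (wlift g) (map mono s).
Proof.
move=> rs; rewrite -(@dsum_conv_prefix g x [::] s rs); congr (_ + _).
have ux : unrun [:: x] = pow x by exact: cats0.
(* No cut falls inside the first block, whose letter is not [~~ x.1]. *)
rewrite -cat1s unrun_cat ux /dsum size_cat big_split_ord /= big1 ?add0r.
  apply: eq_big => i; rewrite nth_cat ltnNge leq_addr addKn // => _.
  by rewrite take_cat drop_cat ltnNge leq_addr addKn.
move=> i; rewrite nth_cat ltn_ord nth_nseq -[x.2](size_nseq _ x.1) ltn_ord => /eqP.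
by case: (x.1).
Qed.



End BlockSums.

(** * The conditional expectation E^psi_X and its Boolean recursion *)

Lemma big_tuple_bool_cons (V : nmodType) d (F : d.+1.-tuple bool -> V) :
  \sum_(t : d.+1.-tuple bool) F t =
  \sum_(t : d.-tuple bool) F [tuple of true :: t] +
  \sum_(t : d.-tuple bool) F [tuple of false :: t].
Proof.
rewrite (reindex (fun bt : bool * d.-tuple bool => [tuple of bt.1 :: bt.2])) /=; last first.
  exists (fun t => (thead t, [tuple of behead t])) => [[b t] _ | t _] /=.
    by congr (_, _); apply: val_inj.
  by rewrite [RHS]tuple_eta; apply: val_inj.
by rewrite -(pair_bigA _ (fun b (t : d.-tuple bool) => F [tuple of b :: t])) /= big_bool.
Qed.

Section ConditionalExpectation.
Variable psi : word -> C.

(* The sum over cut sets in [EpsiX], read from left to right: [acc] lists the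
   arguments since the last cut, [x] is the X-block where one may cut next, and
   [ys] the remaining pairs. *)
Fixpoint epsr (acc : seq word) (x : word) (ys : seq (word * word)) : {poly C} :=
  if ys is p :: ys' then
    bcum psi acc *: ('X^(size x) * epsr [:: p.1] p.2 ys')
    + epsr (acc ++ [:: x; p.1]) p.2 ys'
  else bcum psi acc *: 'X^(size x).

Local Notation nthp := (nth ([::], [::])).

Lemma segS ys a j : (a <= j < size ys)%N ->
  seg ys a j.+1 =
  flatten [seq [:: p.1; p.2] | p <- take (j - a) (drop a ys)] ++ [:: (nthp ys j).1].
Proof.
case/andP=> aj js; rewrite /seg subSn //.
have lt : (j - a < size (drop a ys))%N by rewrite size_drop ltn_sub2r // (leq_ltn_trans aj).
rewrite (take_nth ([::], [::])) // nth_drop subnKC // map_rcons -cats1 flatten_cat.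
set L := flatten _; set p := nthp _ _.
have sL : size L = (2 * (j - a))%N.
  rewrite /L; move: (j - a)%N lt => k; elim: k (drop a ys) => [|k IHk] [|q r] //= lt.
  by rewrite IHk // mulnS.
have -> : (2 * (j - a).+1 - 1 = (2 * (j - a)).+1)%N by rewrite mulnS.
by rewrite take_cat sL ltnNge leqnSn subSnn.
Qed.

Lemma seg1 ys j : (j < size ys)%N -> seg ys j j.+1 = [:: (nthp ys j).1].
Proof. by move=> h; rewrite segS ?leqnn // subnn take0. Qed.

Lemma segSS ys a j : (a < j < size ys)%N ->
  seg ys a j.+1 = seg ys a j ++ [:: (nthp ys j.-1).2; (nthp ys j).1].
Proof.
case: j => // j /andP[aj js]; rewrite segS ?(ltnW aj) // segS; last first.
  by rewrite -ltnS aj (ltn_trans _ js).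
rewrite subSn // (take_nth ([::], [::])); last first.
  by rewrite size_drop ltn_sub2r ?(ltnW js) // (leq_ltn_trans _ (ltnW js)).
by rewrite nth_drop subnKC // map_rcons -cats1 flatten_cat -!catA.
Qed.

(** Here [a] is the last cut made, [j] the next candidate and [d] the number of candidates left. The
    first bit decides on [j]: a cut restarts the accumulator at the next Y-block, no cut extends it
    by an X-block and a Y-block. *)
Lemma cut_sum_epsr ys d a j : (a < j)%N -> (j + d)%N = size ys ->
  \sum_(t : d.-tuple bool)
    'X^(\sum_(i <- mask t (iota j d)) size (nthp ys i.-1).2 + size (nthp ys (size ys).-1).2)
    * (\prod_(ab <- zip (a :: rcons (mask t (iota j d)) (size ys))
                        (rcons (mask t (iota j d)) (size ys)))
          bcum psi (seg ys ab.1 ab.2))%:P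
  = epsr (seg ys a j) (nthp ys j.-1).2 (drop j ys).
Proof.
elim: d a j => [|d IH] a j aj jd.
  rewrite addn0 in jd; rewrite (big_pred1 [tuple]) => [|t]; last by apply/esym/eqP; exact: tuple0.
  by rewrite /= big_nil big_seq1 add0n jd drop_size /= mulrC mul_polyC.
have js : (j < size ys)%N by rewrite -jd -addSnnS leq_addr.
rewrite big_tuple_bool_cons (drop_nth ([::], [::]) js) /=.
rewrite -(@segSS ys a j) ?aj // -seg1 // -!IH ?ltnS ?leqnn ?addSnnS //; last exact: ltnW.
congr (_ + _); rewrite big_distrr /= scaler_sumr; apply: eq_bigr => t _.
by rewrite !big_cons /= -addnA exprD polyCM -mul_polyC; ring.
Qed.

Lemma EpsiX_pairs W p ys : YXpairs W = p :: ys ->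
  EpsiX psi W = 'X^(size (X0 W)) * epsr [:: p.1] p.2 ys.
Proof.
move=> e; rewrite /EpsiX e [size _]/=.
have := @cut_sum_epsr (p :: ys) (size ys) 0 1 isT (add1n _).
rewrite seg1 // drop1 /= => <-; rewrite big_distrr; apply: eq_bigr => t _ /=.
by rewrite -addnA exprD mulrA.
Qed.

(** For blocks [s] following a Y-block: [rest_head] is the X-block paired with it, empty at the end
    of the word, and [rest_pairs] are the later pairs. *)
Definition rest_pairs (s : seq (bool * nat)) := pairup (behead (map pow s)).
Definition rest_head (s : seq (bool * nat)) := head [::] (map pow s).

Lemma pairup_pow x s : pairup (map pow (x :: s)) = (pow x, rest_head s) :: rest_pairs s.
Proof. by case: s. Qed.

Lemma EpsiX_Y k s : runs ((lY, k) :: s) ->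
  EpsiX psi (unrun ((lY, k) :: s)) = epsr [:: nseq k lY] (rest_head s) (rest_pairs s).
Proof.
move=> rs; have e : YXpairs (unrun ((lY, k) :: s)) = (nseq k lY, rest_head s) :: rest_pairs s.
  rewrite -[nseq k lY]/(pow (lY, k)) -pairup_pow -blocks_unrun //; case: k rs => // /runs_pos //.
rewrite (EpsiX_pairs e) /X0; case: k rs {e} => [/runs_pos|k rs] //.
by rewrite mul1r.
Qed.

Lemma EpsiX_XY n k s : runs ((lX, n) :: (lY, k) :: s) ->
  EpsiX psi (unrun ((lX, n) :: (lY, k) :: s)) = 'X^n * EpsiX psi (unrun ((lY, k) :: s)).
Proof.
move=> rs; rewrite (EpsiX_Y (runs_cons rs)).
have bl := blocks_unrun rs; case: n rs bl => [/runs_pos|n rs bl] //.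
have e : YXpairs (unrun ((lX, n.+1) :: (lY, k) :: s)) = (nseq k lY, rest_head s) :: rest_pairs s.
  by rewrite -[nseq k lY]/(pow (lY, k)) -pairup_pow -[YXpairs _]/(pairup (behead (blocks _))) bl.
by rewrite (EpsiX_pairs e) -[X0 _]/(head [::] (blocks _)) bl /= size_nseq.
Qed.

Lemma EpsiX_X n : EpsiX psi (nseq n lX) = 'X^n.
Proof.
case: n => [|n]; first by rewrite /EpsiX /= expr0.
have bl : blocks (nseq n.+1 lX) = [:: nseq n.+1 lX].
  by have := @blocks_unrun [:: (lX, n.+1)]; rewrite unrun_cons cats0 => ->.
have e : YXpairs (nseq n.+1 lX) = [::].
  by rewrite -[YXpairs _]/(pairup (behead (blocks (nseq n.+1 lX)))) bl.
have e0 : X0 (nseq n.+1 lX) = nseq n.+1 lX.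
  by rewrite -[X0 _]/(head [::] (blocks (nseq n.+1 lX))) bl.
by rewrite /EpsiX e e0 size_nseq.
Qed.

(** Prepending X lengthens or creates the block X_0, which enters only as a left factor. *)
Lemma EpsiX_Xcons w : EpsiX psi (lX :: w) = 'X * EpsiX psi w.
Proof.
have [[|[[] n] s] rs ->] := ex_runs w.
- by rewrite [unrun _]/= (EpsiX_X 0) (EpsiX_X 1) mulr1.
- case: s rs => [|[[] k] s] rs.
  + by rewrite unrun_cons cats0 EpsiX_X -/(nseq n.+1 lX) (EpsiX_X n.+1) exprS.
  + by case/andP: rs.
  + rewrite -[_ :: _]/(unrun ((lX, n.+1) :: (lY, k) :: s)) !EpsiX_XY ?runs_incr //.
    by rewrite exprS mulrA.
- by rewrite -[_ :: _]/(unrun ((lX, 1%N) :: (lY, n) :: s)) EpsiX_XY.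
Qed.

Lemma wlift_EpsiX_X p L : wlift (EpsiX psi) ((lX, p) :: L) = p * wlift (EpsiX psi) L.
Proof.
rewrite wlift_cons; elim/poly_span_ind: p => [a p q IHp IHq|k].
  by rewrite psum_lin IHp IHq mulrDl scalerAl.
rewrite psum_Xn; elim: k => [|k IH]; first by rewrite mul1r.
rewrite exprS -mulrA -IH big_distrr; apply: eq_bigr => a _ /=.
by rewrite EpsiX_Xcons scalerAr.
Qed.

Hypotheses (psi1 : psi [::] = 1) (mixed : mixed_vanish (mom psi)).

(** [t] holds the blocks since the last cut. [epsr] passes an X-block and a Y-block at once, the
    convolution one block at a time; the additional cuts, right after an X-block, carry cumulants
    from Y to X and vanish. *)
Lemma epsr_conv t s :
  runs (t ++ s) -> t != [::] -> (head (lX, 0%N) t).1 = lY -> (last (lX, 0%N) t).1 = lY ->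
  epsr (map pow t) (rest_head s) (rest_pairs s) =
  conv (fun u => cum (mom psi) (map mono t ++ u)) (wlift (EpsiX psi)) (map mono s).
Proof.
have [n] := ubnP (size s); elim: n s t => // n IH [|[b k] s] t; rewrite ltnS => le rs t0 ht lt.
  rewrite /= conv_nil wlift_nil cats0 bcum_pow //; congr (_ *: _).
have eb : b = lX.
  case: t rs lt {t0 ht} => // x t /andP[/= + _] lt.
  rewrite cat_path /= => /andP[_ /andP[+ _]].
  by move: lt; rewrite /= => ->; case: (b).
subst b.
have vanish : cum (mom psi) (map mono t ++ [:: mono (lX, k)]) = 0.
  case: t ht t0 {rs lt} => // x t /= ht _; rewrite mixed //= last_cat /=.
  by rewrite ht.
rewrite [map _ _]/= conv_cons cats0 -map_cons wlift_mono -/(unrun _).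
rewrite -bcum_pow //.
case: s le rs => [|[b m] s] le rs.
  rewrite conv_nil vanish scale0r addr0 unrun_cons cats0 EpsiX_X /=.
  by rewrite size_nseq.
have rs' : runs ((lX, k) :: (b, m) :: s) by case/runs_cat/andP: rs.
have eb : b = lY by case/andP: rs'; case: (b).
subst b.
rewrite -/(map mono s) conv_cons vanish scale0r add0r.
rewrite EpsiX_XY // EpsiX_Y ?(runs_cons rs') // /rest_pairs [behead _]/= pairup_pow.
rewrite [LHS]/= size_nseq; congr (_ + _).
have := IH s (t ++ [:: (lX, k); (lY, m)]).
rewrite map_cat => -> //; first by apply: eq_conv => u; rewrite map_cat -catA.
- by apply: leq_trans le; exact: leqnSn.
- by rewrite -catA.
- by case: (t).
- by case: (t) ht.
- by rewrite last_cat.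
Qed.

(** Alternating lists of positive powers spell words in block form; there the claim is [epsr_conv]
    with only the first Y-block accumulated. *)
Lemma EpsiX_bdefect L : (head (lX, 0) L).1 = lY ->
  bdefect (mom psi) (wlift (EpsiX psi)) L = 0.
Proof.
apply: (@bdefect_vanish _ _ _ _ _ lY (mom_free psi) _ mixed (wlift_free _)
  (@spanning_monomials _)).
  by rewrite mom_nil.
move=> {}L alt good.
have [s eL ps] : exists2 s, L = map mono s & all (fun u => 0 < u.2)%N s.
  elim: L good {alt} => [|[b p] L IH] good; first by exists [::].
  have [k /= ->] := good (b, p) (mem_head _ _).
  have [|s -> ps] := IH; first by move=> u uL; apply: good; rewrite inE uL orbT.
  by exists ((b, k.+1) :: s).
rewrite eL alternating_mono in alt *; case: s {eL good} alt ps => [|[b k] s] // alt ps /= e.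
subst b; have rs : runs ((lY, k) :: s) by rewrite /runs alt.
rewrite -map_cons wlift_mono -/(unrun _) EpsiX_Y //.
rewrite -[[:: nseq k _]]/(map pow [:: (lY, k)]) epsr_conv //.
by rewrite subrr.
Qed.

End ConditionalExpectation.

HB.instance Definition _ (V : lmodType C) (h : nat -> V) :=
  GRing.isLinear.Build C {poly C} V *:%R (psum h) (fun a p q => psum_lin h a p q).

Lemma psum_mulXn (u p : {poly C}) : psum (fun k => u * 'X^k) p = u * p.
Proof.
elim/poly_span_ind: p => [a p q IHp IHq|k]; last exact: psum_Xn.
by rewrite psum_lin IHp IHq mulrDr scalerAr.
Qed.

Lemma conv_centered (K : comNzRingType) (m n : seq (bool * {poly K}) -> K)
    (V : lmodType K) (g : seq (bool * {poly K}) -> V) x s :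
  (forall L, alternating L -> (forall u, u \in L -> n [:: u] = 0) ->
     m L = \prod_(u <- L) m [:: u]) ->
  alternating (x :: s) -> (forall u, u \in x :: s -> n [:: u] = 0) ->
  conv (bpart m [:: x]) g s = m [:: x] *: g s.
Proof.
move=> cf alt cen; rewrite /conv big_ord_recl take0 drop0 big1 ?addr0 // => i _.
case: s alt cen i => [|y s] alt cen [i hi] //.
rewrite (@bpart_centered _ m n cf [:: x] y (take i s)) ?scale0r //.
  have h := cat_take_drop i s; rewrite -h -[x :: y :: _]/((x :: y :: take i s) ++ _) in alt.
  by have [] := cat_sorted2 alt.
move=> u hu; apply: cen; move: hu.
by rewrite !inE => /or3P[-> //|->|/mem_take ->]; rewrite !orbT.
Qed.

(** * Recursions along the letters of a word *)

Section WordRecursions.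
Variable V : lmodType C.

(** Applied to the block list of a word, a vanishing defect becomes through [dsum_conv] a recursion
    of the shape of (iii). *)
Lemma bdefect_word (theta : word -> C) (g : word -> V) l :
  theta [::] = 1 -> mixed_vanish (mom theta) ->
  (forall L, (head (~~ l, 0) L).1 = l -> bdefect (mom theta) (wlift g) L = 0) ->
  forall w, g (l :: w) =
    bb theta l (l :: w) *: g [::] + dsum (~~ l) (bb theta l) g (l :: w).
Proof.
move=> th1 mixed gl w; have [[|x s] rs e] := ex_runs (l :: w) => //.
have ex : x.1 = l by rewrite -(head_unrun l rs) -e.
rewrite e -[in LHS](wlift_mono g) -ex dsum_conv //.
by apply/eqP; rewrite -subr_eq0; apply/eqP; apply: (gl (map mono (x :: s))).
Qed.

(** As [a] is not a cut letter, [g] is evaluated on proper suffixes only; every induction along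
    (iii) and (iv) rests on this. *)
Lemma eq_dsum l f (g g' : word -> V) a w : a != l ->
  (forall v, (size v <= size w)%N -> g v = g' v) ->
  dsum l f g (a :: w) = dsum l f g' (a :: w).
Proof.
move=> al e; apply: eq_bigr => -[[|i] hi] /= h; first by rewrite h in al.
by rewrite e // size_drop leq_subr.
Qed.

Lemma dsum_rcons l f (g : word -> V) w a :
  dsum l f g (rcons w a) =
  dsum l f (fun v => g (rcons v a)) w + (if a == l then f w *: g [:: a] else 0).
Proof.
rewrite {1}/dsum size_rcons big_mkcond big_ord_recr /= nth_rcons ltnn eqxx.
rewrite -cats1 take_size_cat // drop_size_cat //; congr (_ + _).
rewrite /dsum [RHS]big_mkcond; apply: eq_bigr => i _ /=.
rewrite nth_cat ltn_ord takel_cat ?(ltnW (ltn_ord i)) // drop_cat ltn_ord.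
by rewrite cats1.
Qed.

Lemma dsum_nseq l f (g : word -> V) k b : b != l -> dsum l f g (nseq k b) = 0.
Proof.
move=> bl; rewrite /dsum big1 // => i; rewrite nth_nseq.
by have := ltn_ord i; rewrite {2}size_nseq => ->; rewrite (negPf bl).
Qed.

End WordRecursions.

Lemma dsum_linear (V W : lmodType C) (h : {linear V -> W}) l f (g : word -> V) w :
  h (dsum l f g w) = dsum l f (fun v => h (g v)) w.
Proof. by rewrite linear_sum; apply: eq_bigr => i _; rewrite linearZ. Qed.

Lemma dtensE l f g w : dtens l f g w = dsum l f g w.
Proof. by []. Qed.

(** * Consequences of c-freeness for phi, psi and E^psi_X *)

Section Theorem6.
Variables phi psi : word -> C.
Hypotheses (phi1 : phi [::] = 1) (psi1 : psi [::] = 1) (cf : c_free phi psi).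

Lemma mom_seq1 theta u : mom theta [:: u] = app theta (emb u.1 u.2).
Proof.
case: u => b p; rewrite /mom wlift_cons -[RHS]/(lsum (theta : word -> C^o) _) lsum_emb.
by apply: eq_psum => k; rewrite wlift_nil cats0.
Qed.

Lemma mom_centered L : alternating L -> L != [::] ->
  (forall u, u \in L -> mom psi [:: u] = 0) ->
  mom psi L = 0 /\ mom phi L = \prod_(u <- L) mom phi [:: u].
Proof.
move=> alt L0 cen; have [||h1 h2] := cf _ alt.
- by case: (L) L0.
- by move=> u uL; rewrite -mom_seq1 cen.
by split; [exact: h1 | rewrite [LHS]h2; apply: eq_bigr => u _; rewrite mom_seq1].
Qed.

Lemma mom_phi_centered L : alternating L -> (forall u, u \in L -> mom psi [:: u] = 0) ->
  mom phi L = \prod_(u <- L) mom phi [:: u].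
Proof.
case: L => [|x L] alt cen; first by rewrite mom_nil big_nil.
by case: (mom_centered alt isT cen).
Qed.

(** Both sides vanish on nonempty lists, so the pair [(psi, psi)] qualifies for [cfree_mixed_vanish]
    too. *)
Lemma mom_psi_centered L : alternating L -> (forall u, u \in L -> mom psi [:: u] = 0) ->
  mom psi L = \prod_(u <- L) mom psi [:: u].
Proof.
case: L => [|x L] alt cen; first by rewrite mom_nil big_nil.
case: (mom_centered alt isT cen) => -> _.
by rewrite big_cons cen ?mem_head // mul0r.
Qed.

Lemma mixed_phi : mixed_vanish (mom phi).
Proof.
by apply: (cfree_mixed_vanish (mom_free phi) _ (mom_free psi) _ mom_phi_centered);
  rewrite mom_nil.
Qed.

Lemma mixed_psi : mixed_vanish (mom psi).
Proof.
by apply: (cfree_mixed_vanish (mom_free psi) _ (mom_free psi) _ mom_psi_centered);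
  rewrite mom_nil.
Qed.

Lemma wlift_EpsiX_centered x s : alternating (x :: s) -> x.1 = lY ->
  (forall u, u \in x :: s -> mom psi [:: u] = 0) -> wlift (EpsiX psi) (x :: s) = 0.
Proof.
move=> alt ex cen; have /= := EpsiX_bdefect psi1 mixed_psi (L := x :: s) ex.
rewrite (conv_centered _ mom_psi_centered alt cen) cen ?mem_head // scale0r subr0.
exact.
Qed.

Definition evX (theta : word -> C) : {poly C} -> C^o := psum (fun k => theta (nseq k lX) : C^o).

HB.instance Definition _ theta := GRing.Linear.on (evX theta).

Lemma appXE theta p : appX theta p = evX theta p.
Proof. by rewrite /evX -lsum_emb. Qed.

Definition phi_gap (w : word) : C^o := phi w - evX phi (EpsiX psi w).

Lemma wlift_phi_gap L : wlift phi_gap L = mom phi L - evX phi (wlift (EpsiX psi) L).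
Proof. by rewrite wlift_sub (wlift_comp (evX phi)). Qed.

Lemma phi_gap_nil : phi_gap [::] = 0.
Proof.
by rewrite /phi_gap -[[::]]/(nseq 0 lX) EpsiX_X /evX psum_Xn subrr.
Qed.

Lemma phi_gap_bdefect L : (head (lY, 0) L).1 = lX ->
  bdefect (mom phi) (wlift phi_gap) L = 0.
Proof.
apply: (@bdefect_vanish _ _ _ _ _ lX (mom_free phi) _ mixed_phi (wlift_free _)
  (spanning_centered (mom_free psi) _)); rewrite ?mom_nil //.
move=> {}L alt cen; case: L alt cen => [|[b p] [|y s]] alt cen //= eb; subst b.
  rewrite conv_nil wlift_nil phi_gap_nil scaler0 subr0 wlift_phi_gap wlift_EpsiX_X.
  rewrite wlift_nil (EpsiX_X _ 0) mulr1 mom_seq1.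
  by rewrite -[emb _ _]/(emb lX p) -[app _ _]/(appX phi p) appXE subrr.
(* The tail starts with Y, so E^psi_X kills it and, by left linearity, the whole list; [phi_gap]
   then agrees with the multiplicative phi on both. *)
have ey : y.1 = lY by case/andP: alt => /=; case: (y.1).
have alts : alternating (y :: s) by case/andP: alt.
have cens u : u \in y :: s -> mom psi [:: u] = 0.
  by move=> us; apply: cen; rewrite inE us orbT.
rewrite (conv_centered _ mom_phi_centered alt cen) !wlift_phi_gap wlift_EpsiX_X.
rewrite wlift_EpsiX_centered // mulr0 linear0 !subr0.
rewrite (mom_phi_centered alt cen) (mom_phi_centered alts cens) big_cons.
exact: subrr.
Qed.

Lemma phi_gap_X w : phi_gap (lX :: w) = dsum lY (bb phi lX) phi_gap (lX :: w).
Proof.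
rewrite (@bdefect_word _ phi _ lX phi1 mixed_phi phi_gap_bdefect).
by rewrite phi_gap_nil scaler0 add0r.
Qed.

Lemma phi_Y w : phi (lY :: w) =
  bb phi lY (lY :: w) + dsum lX (bb phi lY) (phi : word -> C^o) (lY :: w).
Proof.
have h L : (head (lX, 0) L).1 = lY -> bdefect (mom phi) (wlift (phi : word -> C^o)) L = 0.
  case: L => // x L _; rewrite /= -/(mom phi) conv_bpart_moment ?mom_nil //.
  exact: subrr.
by rewrite [LHS](@bdefect_word _ phi _ lY phi1 mixed_phi h) phi1 [_ *: _]mulr1.
Qed.

Lemma EpsiX_lY w : EpsiX psi (lY :: w) =
  (bb psi lY (lY :: w))%:P + dsum lX (bb psi lY) (EpsiX psi) (lY :: w).
Proof.
rewrite [LHS](@bdefect_word _ psi _ lY psi1 mixed_psi (EpsiX_bdefect psi1 mixed_psi)).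
by rewrite (EpsiX_X _ 0) alg_polyC.
Qed.

(** After appending X the term [bb] vanishes, but the new cut before the last letter restores it
    with the factor ['X]. Serves both E^psi_X and solutions of the recursion. *)
Lemma right_mulX_Y theta (g : word -> {poly C}) w : g [:: lX] = 'X ->
  (forall w, g (lY :: w) = (bb theta lY (lY :: w))%:P + dsum lX (bb theta lY) g (lY :: w)) ->
  (forall v, (size v <= size w)%N -> g (rcons v lX) = g v * 'X) ->
  g (rcons (lY :: w) lX) = g (lY :: w) * 'X.
Proof.
move=> gX gY IH; rewrite rcons_cons !gY -rcons_cons dsum_rcons eqxx gX.
rewrite bb_last_neq ?last_rcons // polyC0 add0r mulrDl mul_polyC addrC; congr (_ + _).
rewrite (@eq_dsum _ _ _ _ (fun v => g v * 'X)) //.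
by rewrite /dsum big_distrl; apply: eq_bigr => i _; rewrite scalerAl.
Qed.

Lemma EpsiX_rcons w : EpsiX psi (rcons w lX) = EpsiX psi w * 'X.
Proof.
have [n] := ubnP (size w); elim: n w => // n IH [|[] w]; rewrite ltnS => le.
- by rewrite (EpsiX_X _ 1) (EpsiX_X _ 0) mul1r.
- by rewrite rcons_cons !EpsiX_Xcons IH // mulrA.
- apply: right_mulX_Y EpsiX_lY _; first exact: (EpsiX_X _ 1).
  by move=> v lev; apply: IH; apply: leq_trans le.
Qed.

(** * Existence of a solution of the recursion *)

Fixpoint Ephi_fuel (n : nat) (w : word) : {poly C} :=
  if n is n'.+1 then
    match w with
    | [::] => 1
    | lX :: _ => EpsiX psi w + dtens lY (bb phi lX) (fun v => Ephi_fuel n' v - EpsiX psi v) w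
    | lY :: _ => (bb phi lY w)%:P + dtens lX (bb phi lY) (Ephi_fuel n') w
    end
  else 0.

Definition Ephi (w : word) := Ephi_fuel (size w).+1 w.

Lemma Ephi_fuelE n w : (size w < n)%N -> Ephi_fuel n w = Ephi w.
Proof.
rewrite /Ephi; have : (size w < (size w).+1)%N by [].
move: {2 4}(size w).+1 => n'; elim: n n' w => [|n IH] [|n'] [|[] w] //.
  move=> h1 h2 /=; congr (_ + _); rewrite !dtensE; apply: eq_dsum => // v le.
  by congr (_ - _); apply: IH; apply: leq_ltn_trans le _.
move=> h1 h2 /=; congr (_ + _); rewrite !dtensE; apply: eq_dsum => // v le.
by apply: IH; apply: leq_ltn_trans le _.
Qed.

Lemma Ephi_X w : Ephi (lX :: w) =
  EpsiX psi (lX :: w) + dtens lY (bb phi lX) (fun v => Ephi v - EpsiX psi v) (lX :: w).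
Proof.
rewrite -[LHS]/(_ + dtens lY _ (fun v => Ephi_fuel (size w).+1 v - EpsiX psi v) _).
congr (_ + _); rewrite !dtensE.
by apply: eq_dsum => // v le; rewrite Ephi_fuelE.
Qed.

Lemma Ephi_Y w : Ephi (lY :: w) =
  (bb phi lY (lY :: w))%:P + dtens lX (bb phi lY) Ephi (lY :: w).
Proof.
rewrite -[LHS]/(_ + dtens lX _ (Ephi_fuel (size w).+1) _); congr (_ + _).
rewrite !dtensE.
by apply: eq_dsum => // v le; rewrite Ephi_fuelE.
Qed.

Lemma bb_nseq k : bb phi lY (nseq k.+1 lY) = phi (nseq k.+1 lY).
Proof.
have rs : runs [:: (lY, k.+1)] by [].
have := bb_unrun phi1 mixed_phi rs; rewrite unrun_cons cats0 => ->.
by rewrite [cum _ _]/= -[[:: _]]/(map mono [:: (lY, k.+1)]) /mom wlift_mono /= cats0.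
Qed.

(** Words in one letter admit no cut at the other, so there (iii) and (iv) reduce to their first
    summands and agree with (i) and (ii). *)
Lemma Ephi_spec : Erec_spec phi psi Ephi.
Proof.
split=> [p|p|w|w]; [| |exact: Ephi_Y|exact: Ephi_X].
- rewrite -[LHS]/(lsum _ _) lsum_emb -[RHS]mul1r -psum_mulXn; apply: eq_psum => -[|k].
    by rewrite mulr1.
  by rewrite mul1r (Ephi_X (nseq k lX)) dtensE (@dsum_nseq _ lY _ _ k.+1 lX) //
    addr0 (EpsiX_X _ k.+1).
- rewrite -[LHS]/(lsum _ _) lsum_emb -[app _ _]/(lsum (phi : word -> C^o) _) lsum_emb.
  rewrite -alg_polyC /psum scaler_suml; apply: eq_bigr => i _; rewrite -scalerA.
  congr (_ *: _); case: (nat_of_ord i) => [|k]; first by rewrite phi1 scale1r.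
  by rewrite (Ephi_Y (nseq k lY)) dtensE (@dsum_nseq _ lX _ _ k.+1 lY) //
    addr0 bb_nseq alg_polyC.
Qed.

(** * Uniqueness and properties of solutions *)

Section Solutions.
Variables (E : word -> {poly C}) (spec : Erec_spec phi psi E).

Lemma Erec_nil : E [::] = 1.
Proof.
case: spec => h _ _ _; have := h 1.
by rewrite -[LHS]/(lsum _ _) lsum_emb -(expr0 'X) psum_Xn.
Qed.

Lemma Erec_Ephi : E =1 Ephi.
Proof.
case: (spec) => _ _ hY hX w.
have [n] := ubnP (size w); elim: n w => // n IH [|[] w]; rewrite ltnS => le.
- exact: Erec_nil.
- rewrite hX Ephi_X !dtensE; congr (_ + _); apply: eq_dsum => // v lev.
  by rewrite IH // (leq_trans _ le).
- rewrite hY Ephi_Y !dtensE; congr (_ + _); apply: eq_dsum => // v lev.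
  by rewrite IH // (leq_trans _ le).
Qed.

Lemma evX_Erec w : evX phi (E w) = phi w.
Proof.
case: (spec) => _ _ hY hX.
have [n] := ubnP (size w); elim: n w => // n IH [|[] w]; rewrite ltnS => le.
- by rewrite Erec_nil /evX -(expr0 'X) psum_Xn.
- rewrite hX dtensE linearD dsum_linear.
  (* Under phi the difference in (iv) becomes [phi_gap] on proper suffixes, by induction, and
     [phi_gap_X] resums it. *)
  rewrite (@eq_dsum _ _ _ _ phi_gap) -?phi_gap_X //; last first.
    by move=> v lev; rewrite linearB /= IH // (leq_trans _ le).
  by rewrite /phi_gap addrC subrK.
- rewrite hY dtensE linearD dsum_linear phi_Y; congr (_ + _).
    rewrite -alg_polyC linearZ /= -[evX phi _]/(psum _ 'X^0) psum_Xn phi1; exact: mulr1.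
  by apply: eq_dsum => // v lev; rewrite /= IH // (leq_trans _ le).
Qed.

Lemma Erec_rcons w : E (rcons w lX) = E w * 'X.
Proof.
case: (spec) => hp _ hY hX.
have EX : E [:: lX] = 'X.
  by have := hp 'X; rewrite -[LHS]/(lsum _ _) lsum_emb -['X]expr1 psum_Xn.
have [n] := ubnP (size w); elim: n w => // n IH [|[] w]; rewrite ltnS => le.
- by rewrite EX Erec_nil mul1r.
- rewrite rcons_cons !hX !dtensE -rcons_cons EpsiX_rcons dsum_rcons addr0 mulrDl.
  congr (_ + _).
  rewrite (@eq_dsum _ _ _ _ (fun v => (E v - EpsiX psi v) * 'X)) //.
    by rewrite /dsum big_distrl; apply: eq_bigr => i _; rewrite scalerAl.
  by move=> v lev; rewrite EpsiX_rcons IH ?mulrBl // (leq_trans _ le).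
- apply: right_mulX_Y hY _ => // v lev.
  by apply: IH; apply: leq_trans le.
Qed.

Lemma Erec_nseq w k : E (w ++ nseq k lX) = E w * 'X^k.
Proof.
elim: k => [|k IH]; first by rewrite cats0 mulr1.
by rewrite -addn1 nseqD catA cats1 Erec_rcons IH exprD mulrA.
Qed.

(** If [w] starts with [a], the cuts at [a] meet the functional of the other letter, which on their
    prefixes is nonzero only at the empty one; subtracting epsilon removes it. Cuts at the other
    letter have nonempty prefixes, where [bbo] equals [bb]. *)
Lemma Erec_explicit w :
  E w = (bb phi lY w)%:P + dtens lX (bbo phi lY) E w
        + dtens lY (bbo phi lX) (fun v => E v - EpsiX psi v) w + XEpsiLX psi w.
Proof.
have bbo_cons l a v : bbo phi l (a :: v) = bb phi l (a :: v).
  by rewrite /bbo /eps subr0.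
have dtens_same l g a v : a = l -> dtens l (bbo phi (~~ l)) g (a :: v) = 0.
  move=> ->; rewrite /dtens big1 // => -[[|i] hi] _ /=.
    by rewrite /bbo /eps /= subrr scale0r.
  by rewrite bbo_cons bb_head_neq ?scale0r //; case: (l).
have dtens_other l g a v : a != l -> dtens l (bbo phi (~~ l)) g (a :: v) =
    dtens l (bb phi (~~ l)) g (a :: v).
  move=> al; apply: eq_bigr => -[[|i] hi] /= h; first by rewrite h in al.
  by rewrite bbo_cons.
case: (spec) => _ _ hY hX; case: w => [|[] w].
- by rewrite /dtens !big_ord0 !addr0 Erec_nil.
- rewrite hX bb_head_neq // (dtens_same lX) // (dtens_other lY) // polyC0 !add0r.
  by rewrite addrC /= EpsiX_Xcons.
- by rewrite hY (dtens_other lX) // (dtens_same lY) // !addr0.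
Qed.

End Solutions.
End Theorem6.

Theorem theorem6 (phi psi : word -> C) :
  phi [::] = 1 -> psi [::] = 1 ->
  c_free phi psi ->
  (* well defined: the recursion has a solution, and it is unique *)
  (exists E, Erec_spec phi psi E) /\
  (forall E1 E2, Erec_spec phi psi E1 -> Erec_spec phi psi E2 -> E1 =1 E2) /\
  (forall E, Erec_spec phi psi E ->
     (* right quasi-conditional expectation for phi onto C<X> *)
     (forall P : ncpoly, appX phi (linext E P) = app phi P) /\
     (forall (P : ncpoly) (Q : {poly C}),
        linext E (ncmul P (emb lX Q)) = linext E P * Q) /\
     (* the explicit formula *)
     (forall W : word,
        E W = (bb phi lY W)%:P
              + dtens lX (bbo phi lY) E W
              + dtens lY (bbo phi lX) (fun V => E V - EpsiX psi V) W
              + XEpsiLX psi W)).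
Proof.
move=> phi1 psi1 cf; split; first by exists (Ephi phi psi); exact: Ephi_spec.
split=> [E1 E2 spec1 spec2 w|E spec].
  by rewrite (Erec_Ephi spec1) (Erec_Ephi spec2).
split=> [P|]; last split=> [P Q|W]; last exact: Erec_explicit.
- rewrite appXE linear_sum; apply: eq_bigr => cw _.
  by rewrite linearZ /= (evX_Erec phi1 psi1 cf spec).
- rewrite -[LHS]/(lsum E _) lsum_mul /linext big_distrl; apply: eq_bigr => cw _.
  rewrite lsum_emb /= -scalerAl -psum_mulXn; congr (_ *: _); apply: eq_psum => k.
  exact: (Erec_nseq psi1 cf spec).
Qed.
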